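(* Let $\Sigma$ be an alphabet and $\langle\Sigma\rangle$ the free group on $\Sigma$. An element of $\langle\Sigma\rangle$ is a product (in the group) of at most three palindromes if and only if its reduced form is equal, as a concatenation of words (i.e. with no cancellation performed), to $$A\,B\,P\,Q\,B^{-1}\,R\,\overline{A}\quad\text{or}\quad A\,P\,B\,Q\,R\,B^{-1}\,\overline{A},$$ for some (possibly empty) palindromes $P,Q,R$ and some arbitrary (possibly empty) words $A,B$.
   Context: Let $\Sigma_g=\Sigma\cup\{a^{-1} : a\in\Sigma\}$. Elements of $\langle\Sigma\rangle$ are represented by their reduced forms, i.e. words over $\Sigma_g$ in which no letter $a$ is adjacent to $a^{-1}$. For a word $X=x_1x_2\cdots x_n$ with $x_i\in\Sigma_g$, the mirror image is $\overline{X}=x_n\cdots x_2x_1$, and the inverse is $X^{-1}=x_n^{-1}\cdots x_1^{-1}$ with $(a^{-1})^{-1}=a$. A palindrome is a word $P$ with $P=\overline{P}$; the empty word is a palindrome. An element of $\langle\Sigma\rangle$ is called a palindrome if its reduced form is a palindrome. ''The reduced form is a concatenation of the form $W_1W_2\cdots W_m$'' means that the reduced word equals the literal concatenation of the words $W_1,\dots,W_m$ over $\Sigma_g$ (so this concatenation is itself reduced). *)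

(* Defs.v *)
From HB Require Import structures.
From mathcomp Require Import all_boot.

Set Implicit Arguments.
Unset Strict Implicit.
Unset Printing Implicit Defensive.

Local Open Scope group_scope.

(* The letter a is (a, false) and its formal inverse a^-1 is (a, true). *)
Definition letter (Sigma : choiceType) : choiceType := (Sigma * bool)%type.

Definition word (Sigma : choiceType) : choiceType := seq (letter Sigma).

Definition letter_inv (Sigma : choiceType) (x : letter Sigma) : letter Sigma :=
  (x.1, ~~ x.2).

Definition word_inv (Sigma : choiceType) (w : word Sigma) : word Sigma :=
  rev (map (@letter_inv Sigma) w).

Definition palindrome (Sigma : choiceType) (w : word Sigma) : bool :=
  w == rev w.

Definition reduced (Sigma : choiceType) (w : word Sigma) : bool :=
  sorted (fun x y => y != letter_inv x) w.

(* If w is reduced, the reduced form of x :: w. *)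
Definition push (Sigma : choiceType) (x : letter Sigma) (w : word Sigma) :
    word Sigma :=
  if w is y :: w' then if y == letter_inv x then w' else x :: w else [:: x].

Definition reduce (Sigma : choiceType) (w : word Sigma) : word Sigma :=
  foldr (@push Sigma) [::] w.

Record freegroup (Sigma : choiceType) : Type :=
  FreeGroup { reduced_form : word Sigma; _ : reduced reduced_form }.

HB.instance Definition _ (Sigma : choiceType) :=
  [isSub for @reduced_form Sigma].
HB.instance Definition _ (Sigma : choiceType) :=
  [Choice of freegroup Sigma by <:].

Section FreeGroupTheory.
Variable Sigma : choiceType.
Implicit Types (x y : letter Sigma) (u v w : word Sigma) (g h k : freegroup Sigma).

Lemma letter_invK : involutive (@letter_inv Sigma).
Proof. by case=> a b; rewrite /letter_inv /= negbK. Qed.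

Lemma reduced_push x w : reduced w -> reduced (push x w).
Proof.
case: w => [|y w] //= rw; case: ifPn => [_|yx]; first exact: path_sorted rw.
by rewrite /reduced /= yx.
Qed.

Lemma reduced_foldr_push u v : reduced v -> reduced (foldr (@push Sigma) v u).
Proof. by move=> rv; elim: u => //= x u IHu; apply: reduced_push. Qed.

Lemma reduced_reduce w : reduced (reduce w).
Proof. exact: reduced_foldr_push. Qed.

Lemma reduce_id w : reduced w -> reduce w = w.
Proof.
elim: w => // x w IHw rxw; rewrite /= IHw; last exact: path_sorted rxw.
by case: w rxw {IHw} => //= y w /andP[/negPf-> _].
Qed.

Lemma push_invK x w : reduced w -> push x (push (letter_inv x) w) = w.
Proof.
case: w => [|y w] /=; first by rewrite eqxx.
rewrite letter_invK; have [-> {y}|_ _] := eqVneq y x; last by rewrite /= eqxx.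
by case: w => //= z w /andP[/negPf->].
Qed.

Lemma reduce_cat u v : reduce (u ++ v) = foldr (@push Sigma) (reduce v) u.
Proof. exact: foldr_cat. Qed.

Lemma foldr_push_reduce u v :
  reduced v -> foldr (@push Sigma) v (reduce u) = foldr (@push Sigma) v u.
Proof.
move=> rv; elim: u => //= x u <-.
case: (reduce u) => //= y w; case: eqVneq => //= ->.
by rewrite push_invK // reduced_foldr_push.
Qed.

Lemma reduce_catl u v : reduce (reduce u ++ v) = reduce (u ++ v).
Proof. by rewrite !reduce_cat foldr_push_reduce // reduced_reduce. Qed.

Lemma reduce_catr u v : reduce (u ++ reduce v) = reduce (u ++ v).
Proof. by rewrite !reduce_cat reduce_id // reduced_reduce. Qed.

Lemma word_invK : involutive (@word_inv Sigma).
Proof. by move=> w; rewrite /word_inv map_rev revK (mapK letter_invK). Qed.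

Lemma reduced_word_inv w : reduced w -> reduced (word_inv w).
Proof.
rewrite /reduced /word_inv rev_sorted sorted_map; apply: sub_sorted => x y /=.
by apply: contra => /eqP/(can_inj letter_invK) ->; rewrite letter_invK.
Qed.

Lemma reduce_word_invr w : reduce (w ++ word_inv w) = [::].
Proof.
elim: w => //= x w IHw.
rewrite /word_inv /= rev_cons -cats1 catA -reduce_catl IHw /=.
by rewrite eqxx.
Qed.

Definition fg_one : freegroup Sigma := @FreeGroup Sigma [::] isT.
Definition fg_mul g h : freegroup Sigma :=
  FreeGroup (reduced_reduce (reduced_form g ++ reduced_form h)).
Definition fg_inv g : freegroup Sigma :=
  FreeGroup (reduced_word_inv (valP g)).

Lemma fg_mulA : associative fg_mul.
Proof.
by move=> g h k; apply: val_inj; rewrite /= reduce_catr reduce_catl catA.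
Qed.

Lemma fg_mul1g : left_id fg_one fg_mul.
Proof. by move=> g; apply: val_inj; rewrite /= reduce_id ?(valP g). Qed.

Lemma fg_mulg1 : right_id fg_one fg_mul.
Proof. by move=> g; apply: val_inj; rewrite /= cats0 reduce_id ?(valP g). Qed.

Lemma fg_mulgV : right_inverse fg_one fg_inv fg_mul.
Proof. by move=> g; apply: val_inj; rewrite /= reduce_word_invr. Qed.

Lemma fg_mulVg : left_inverse fg_one fg_inv fg_mul.
Proof.
move=> g; apply: val_inj => /=.
by rewrite -{2}(word_invK (reduced_form g)) reduce_word_invr.
Qed.

End FreeGroupTheory.

HB.instance Definition _ (Sigma : choiceType) :=
  isGroup.Build (freegroup Sigma) (@fg_mulA Sigma) (@fg_mul1g Sigma)
    (@fg_mulg1 Sigma) (@fg_mulVg Sigma) (@fg_mulgV Sigma).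

Definition is_palindrome (Sigma : choiceType) (g : freegroup Sigma) : bool :=
  palindrome (reduced_form g).

(* Main.v *)
(* Taking mirror images is an anti-automorphism of the free group, and its fixed
   points are the palindromes.  Hence, writing u~ for the mirror of u, they are
   stable under g |-> u g u~, which splits both normal forms into palindromes.
   Conversely, write g = p q r with palindromes p, q, r of minimal total length.
   If the cancellation in p q reaches beyond the middle of p or of q, then
   p q = 1 or one of p q = (p q p) p^-1 = q^-1 (q p q) is a shorter pair.  So
   p = B P B~ and q = B~^-1 Q B^-1 with B P Q B^-1 reduced; likewise
   q = D Q' D~ and r = D~^-1 R D^-1.  If B = D~^-1 E~^-1, then
   g = D~^-1 E~^-1 P Q E~ R D^-1, which is the first form; the case of D longer
   than B is the mirror image.  This word can only fail to be reduced when Q and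
   E are empty, and then the argument for pairs applies to P and R. *)
Require Import Defs.
From HB Require Import structures.
From mathcomp Require Import all_boot.
From mathcomp Require Import zify.

Set Implicit Arguments.
Unset Strict Implicit.
Unset Printing Implicit Defensive.

(** In the free group, [iv w] is the inverse of the mirror image of [w], written [w~^-1] below; its
    own mirror is [word_inv w]. *)
Local Notation iv := (map (@letter_inv _)).

Section Words.
Variable Sigma : choiceType.
Implicit Types (x y : letter Sigma) (u v w A B P Q R : word Sigma).

Local Notation linv := (@letter_inv Sigma).

(** * Mirror images, inverses and reduced words *)

Lemma rev_word_inv w : rev (word_inv w) = iv w.
Proof. exact: revK. Qed.

Lemma word_inv_rev w : word_inv (rev w) = iv w.
Proof. by rewrite /word_inv map_rev revK. Qed.

Lemma rev_iv w : rev (iv w) = word_inv w.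
Proof. by []. Qed.

Lemma word_inv_iv w : word_inv (iv w) = rev w.
Proof. by rewrite /word_inv (mapK (@letter_invK Sigma)). Qed.

Lemma size_word_inv w : size (word_inv w) = size w.
Proof. by rewrite size_rev size_map. Qed.

Lemma word_inv_cat u v : word_inv (u ++ v) = word_inv v ++ word_inv u.
Proof. by rewrite /word_inv map_cat rev_cat. Qed.

Lemma word_inv_rcons u x : word_inv (rcons u x) = linv x :: word_inv u.
Proof. by rewrite /word_inv map_rcons rev_rcons. Qed.

Lemma ivK w : iv (iv w) = w.
Proof. exact: (mapK (@letter_invK Sigma)). Qed.

Lemma letter_inv_eqC x y : (x == linv y) = (y == linv x).
Proof. by apply/eqP/eqP=> ->; rewrite letter_invK. Qed.

Lemma reduced_rev w : reduced (rev w) = reduced w.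
Proof.
by rewrite /reduced rev_sorted; apply/idP/idP; apply: sub_sorted => x y;
  rewrite letter_inv_eqC.
Qed.

Lemma reduced_catl u v : reduced (u ++ v) -> reduced u.
Proof. by case/cat_sorted2. Qed.

Lemma reduced_catr u v : reduced (u ++ v) -> reduced v.
Proof. by case/cat_sorted2. Qed.

(** Reducedness only constrains adjacent letters, and a nonempty overlap [v] keeps [u] and [w] from
    touching. *)
Lemma reduced_glue u v w :
  v != [::] -> reduced (u ++ v) -> reduced (v ++ w) -> reduced (u ++ v ++ w).
Proof.
case: v => //= x v _; rewrite /reduced !sorted_cat_cons => /andP[-> _].
by move=> /= ->.
Qed.

Lemma reduced_join u x y v :
  reduced (rcons u x ++ y :: v) =
    [&& reduced (rcons u x), reduced (y :: v) & y != linv x].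
Proof.
by rewrite cat_rcons /reduced sorted_cat_cons /= [path _ _ _ && _]andbC.
Qed.

(** This makes the mirror image well defined on the free group. By induction, a letter pushed on the
    left of [w] is one appended on the right of its mirror, with the same cancellation. *)
Lemma reduce_rev w : reduce (rev w) = rev (reduce w).
Proof.
elim: w => //= x w IHw; rewrite rev_cons -cats1 -reduce_catl IHw.
have: reduced (reduce w) by apply: reduced_reduce.
case: (reduce w) => [|y v] //= rv; case: eqVneq => [->|nyx].
  rewrite rev_cons -cats1 -catA -reduce_catr /= letter_invK eqxx cats0.
  by rewrite reduce_id // reduced_rev; apply: path_sorted rv.
by rewrite cats1 -rev_cons reduce_id // reduced_rev /reduced /= nyx.
Qed.

Lemma size_reduce w : size (reduce w) <= size w.
Proof.
elim: w => //= x w; case: (reduce w) => [|y v] //= lvw; case: ifP => _ //=.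
exact: leq_trans (leqnSn _) (leq_trans lvw _).
Qed.

(** * Palindromic words *)

Lemma palindrome_reduce w : palindrome w -> palindrome (reduce w).
Proof. by rewrite /palindrome -reduce_rev => /eqP<-. Qed.

Lemma palindrome_wrap u w : palindrome (u ++ w ++ rev u) = palindrome w.
Proof.
rewrite /palindrome !rev_cat revK -catA eqseq_cat // eqxx.
by rewrite eqseq_cat ?size_rev ?eqxx ?andbT.
Qed.

Lemma palindrome_word_inv w : palindrome (word_inv w) = palindrome w.
Proof.
rewrite /palindrome rev_word_inv -(inj_eq (can_inj (@word_invK Sigma))).
by rewrite word_invK word_inv_iv.
Qed.

Lemma palindromeP w : palindrome w ->
  [\/ w = [::], exists x, w = [:: x]
    | exists x, exists2 v, palindrome v & w = x :: rcons v x].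
Proof.
case: w => [|x w]; first by constructor 1.
case/lastP: w => [|w y] pw; first by constructor 2; exists x.
have: (x == y) && palindrome w.
  move: pw; rewrite /palindrome rev_cons rev_rcons /= eqseq_cons eqseq_rcons.
  by case: (x == y) => //= /andP[].
case/andP=> /eqP<- pw'; constructor 3; exists x, w => //.
Qed.

Lemma palindrome_last x u : palindrome (x :: u) -> exists v, x :: u = rcons v x.
Proof. by rewrite /palindrome rev_cons => /eqP ->; exists (rev u). Qed.

(** * From words to elements of the free group *)

Definition to_fg w : freegroup Sigma := FreeGroup (reduced_reduce w).

Lemma to_fg_cat u v : to_fg (u ++ v) = (to_fg u * to_fg v)%g.
Proof. by apply: val_inj; rewrite /= reduce_catl reduce_catr. Qed.

Lemma to_fg_nil : to_fg [::] = 1%g.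
Proof. exact: val_inj. Qed.

Lemma to_fg_word_inv w : to_fg (word_inv w) = (to_fg w)^-1%g.
Proof.
apply: (mulgI (to_fg w)); rewrite mulgV -to_fg_cat.
by apply: val_inj; rewrite /= reduce_word_invr.
Qed.

Lemma to_fg_iv w : to_fg (iv w) = (to_fg (rev w))^-1%g.
Proof. by rewrite -word_inv_rev to_fg_word_inv. Qed.

Lemma reduced_form_fgK (g : freegroup Sigma) : to_fg (reduced_form g) = g.
Proof. by apply: val_inj; rewrite /= reduce_id // (valP g). Qed.

Lemma to_fg_eq u v : to_fg u = to_fg v <-> reduce u = reduce v.
Proof. by split=> [[]|] // e; apply: val_inj. Qed.

Lemma to_fg_reduce w : to_fg (reduce w) = to_fg w.
Proof. by apply/to_fg_eq; rewrite reduce_id // reduced_reduce. Qed.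

(** Turns equalities of reductions into group identities, where cancellations become rewriting
    steps. *)
Definition to_fgE :=
  (to_fg_nil, to_fg_cat, to_fg_iv, to_fg_word_inv, @mulgA (freegroup Sigma),
   @mulgVK (freegroup Sigma), @mulgK (freegroup Sigma),
   @mulgV (freegroup Sigma), @mul1g (freegroup Sigma),
   @mulg1 (freegroup Sigma)).

(** * Products of two palindromes *)

(** Here [B] records all of the cancellation: it stops by the middle of both words and leaves
    [B P Q B^-1] as the reduced form of [p q]. *)
Definition aligned p q := exists B P Q,
  [/\ palindrome P, palindrome Q, p = B ++ P ++ rev B,
      q = iv B ++ Q ++ word_inv B & reduced (B ++ P ++ Q ++ word_inv B)].

Definition shortenable p q := exists p' q',
  [/\ palindrome p', palindrome q', size p' + size q' < size p + size q
    & to_fg (p' ++ q') = to_fg (p ++ q)].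

(** Since [(p q)^-1 = q^-1 p^-1], inversion exchanges the two factors; the case of an empty [Q] is
    thereby reduced to that of an empty [P]. *)
Lemma aligned_inv p q : aligned (word_inv q) (word_inv p) -> aligned p q.
Proof.
case=> B [P [Q [pP pQ]]].
move=> /(congr1 (@word_inv Sigma)) + /(congr1 (@word_inv Sigma)).
rewrite !word_invK !word_inv_cat word_inv_rev word_inv_iv word_invK -!catA.
move=> eq ep rBPQ; exists B, (word_inv Q), (word_inv P).
split; rewrite ?palindrome_word_inv //.
by move/reduced_word_inv: rBPQ; rewrite !word_inv_cat word_invK -!catA.
Qed.

Lemma shortenable_inv p q :
  shortenable (word_inv q) (word_inv p) -> shortenable p q.
Proof.
case=> p' [q' [pp' pq']]; rewrite !size_word_inv => lt e.
exists (word_inv q'), (word_inv p'); split; rewrite ?palindrome_word_inv //.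
  by rewrite !size_word_inv addnC [size p + _]addnC.
rewrite -word_inv_cat to_fg_word_inv e -to_fg_word_inv.
by rewrite word_inv_cat !word_invK.
Qed.

(** The inner [B~ B~^-1] cancels, so the product is [P Q] conjugated by [B], and any shorter pair
    for [P Q] can be wrapped in the same way. *)
Lemma shortenable_wrap B P Q :
  shortenable P Q -> shortenable (B ++ P ++ rev B) (iv B ++ Q ++ word_inv B).
Proof.
case=> P' [Q' [pP' pQ' lt e]].
exists (B ++ P' ++ rev B), (iv B ++ Q' ++ word_inv B); split.
- by rewrite palindrome_wrap.
- by rewrite -[word_inv B]/(rev (iv B)) palindrome_wrap.
- by rewrite !size_cat; lia.
- by move: e; rewrite !to_fgE => e; rewrite -!(mulgA (to_fg B)) e.
Qed.

(** Either the second word is [x^-1] and the product is trivial, or it is [x^-1 v x^-1] and the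
    product is [v x^-1]. *)
Lemma shortenable_letter x u :
  palindrome (linv x :: u) -> shortenable [:: x] (linv x :: u).
Proof.
case/palindromeP=> [|[y]|[y [v pv]]] // [yx ->]; rewrite -?{y}yx.
  by exists [::], [::]; split=> //; apply: val_inj; rewrite /= eqxx.
exists v, [:: linv x]; split=> //; first exact: eqxx.
  by rewrite /= size_rcons; lia.
rewrite -cats1 (_ : [:: x] ++ _ =
  [:: x] ++ word_inv [:: x] ++ v ++ [:: linv x]) //.
by rewrite !to_fgE.
Qed.

(** The cancellation swallows [x x] entirely: what remains is [x^-1] or [v x^-2]. *)
Lemma shortenable_letter_sq x u :
  palindrome (linv x :: u) ->
  shortenable [:: x; x] (linv x :: rcons (linv x :: u) (linv x)).
Proof.
case/palindromeP=> [|[y]|[y [v pv]]] // [yx ->]; rewrite -?{y}yx.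
  exists [::], [:: linv x]; split=> //; first exact: eqxx.
  rewrite (_ : [:: x; x] ++ _ =
    [:: x] ++ [:: x] ++ word_inv [:: x] ++ word_inv [:: x] ++ [:: linv x]) //.
  by rewrite !to_fgE.
exists v, [:: linv x; linv x]; split=> //; first exact: eqxx.
  by rewrite /= !size_rcons; lia.
rewrite (_ : [:: x; x] ++ _ =
  [:: x] ++ [:: x] ++ word_inv [:: x] ++ word_inv [:: x] ++
  v ++ [:: linv x; linv x]).
  by rewrite !to_fgE.
by rewrite -!cats1 /= -!catA.
Qed.

(** With [P] empty, [Q] meets the last letter [b] of [B]. If [Q] starts with [b^-1], the middle
    [b b] of [p] faces [b^-1 Q b^-1], which can be shortened. *)
Lemma aligned_or_shortenable_nil B Q :
  palindrome Q -> reduced (B ++ rev B) -> reduced (iv B ++ Q ++ word_inv B) ->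
  let p := B ++ rev B in let q := iv B ++ Q ++ word_inv B in
  aligned p q \/ shortenable p q.
Proof.
move=> pQ rp rq p q; case/lastP: B => [|B b] in rp rq p q *.
  left; exists [::], [::], Q; split=> //.
have ep : p = B ++ [:: b; b] ++ rev B.
  by rewrite /p rev_rcons cat_rcons.
have eq : q = iv B ++ (linv b :: rcons Q (linv b)) ++ word_inv B.
  by rewrite /q map_rcons word_inv_rcons cat_rcons /= cat_rcons.
case: Q => [|y w] in pQ rq q eq *.
  (* With [Q] empty as well, [q] is the inverse of [p]. *)
  right; exists [::], [::]; split=> //.
    by rewrite ep !size_cat /=; lia.
  by rewrite !to_fgE.
have [yb|nyb] := eqVneq y (linv b).
  right; rewrite ep eq yb.
  by apply/shortenable_wrap/shortenable_letter_sq; rewrite -yb.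
left; exists (rcons B b), [::], (y :: w); split=> //.
apply: (@reduced_glue _ (y :: w)) => //; last exact: reduced_catr rq.
rewrite reduced_join nyb andbT (reduced_catl rp) /=.
exact: reduced_catl (reduced_catr rq).
Qed.

(** Induction on [P]: as long as its last letter, which is also its first, cancels against [Q], the
    outer letters of [P] and [Q] move into [B] and its counterparts. The process ends at a reduced
    junction or when a core has at most one letter. *)
Lemma aligned_or_shortenable B P Q :
  palindrome P -> palindrome Q ->
  reduced (B ++ P ++ rev B) -> reduced (iv B ++ Q ++ word_inv B) ->
  let p := B ++ P ++ rev B in let q := iv B ++ Q ++ word_inv B in
  aligned p q \/ shortenable p q.
Proof.
have [n] := ubnP (size P); elim: n B P Q => // n IHn B P Q leP pP pQ rp rq p q.
case: P => [|x u] in leP pP rp p *; first exact: aligned_or_shortenable_nil.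
case: Q => [|y w] in pQ rq q *.
  have: aligned (word_inv q) (word_inv p) \/
    shortenable (word_inv q) (word_inv p).
    have := @aligned_or_shortenable_nil B (word_inv (x :: u)).
    rewrite palindrome_word_inv /p /q !word_inv_cat word_inv_iv.
    rewrite word_inv_rev word_invK -!catA /=.
    apply=> //.
      move/reduced_word_inv: rq.
      by rewrite cat0s word_inv_cat word_inv_iv word_invK.
    by move/reduced_word_inv: rp; rewrite !word_inv_cat word_inv_rev -catA.
  by case=> [/aligned_inv|/shortenable_inv]; [left|right].
have [v eqP] := palindrome_last pP.
have [yx|nyx] := eqVneq y (linv x); last first.
  left; exists B, (x :: u), (y :: w); split=> //.
  apply: reduced_glue => //.
    by rewrite catA in rp; apply: reduced_catl rp.
  apply: (@reduced_glue _ (y :: w)) => //; last exact: reduced_catr rq.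
  rewrite eqP reduced_join nyx andbT -eqP.
  move/reduced_catr/reduced_catl: rp => ->.
  by move/reduced_catr/reduced_catl: rq => ->.
rewrite {y}yx in pQ rq q *.
case/palindromeP: (pP) => [|[z]|[z [P pP']]] // [zx eu]; subst z u.
  by right; apply/shortenable_wrap/shortenable_letter.
(* A one-letter [Q] becomes a one-letter first factor after inversion. *)
case/palindromeP: (pQ) => [|[z]|[z [Q pQ']]] // [zx ew]; subst z w.
  right; apply/shortenable_wrap/shortenable_inv.
  have := @shortenable_letter x (word_inv (x :: P)).
  rewrite -word_inv_rcons palindrome_word_inv rcons_cons => /(_ pP).
  by rewrite /word_inv /= letter_invK.
have ep : p = rcons B x ++ P ++ rev (rcons B x).
  by rewrite /p rev_rcons cat_rcons /= cat_rcons.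
have eq : q = iv (rcons B x) ++ Q ++ word_inv (rcons B x).
  by rewrite /q map_rcons word_inv_rcons cat_rcons /= cat_rcons.
rewrite ep eq; apply: IHn; rewrite -?ep -?eq //.
by move: leP; rewrite /= size_rcons; lia.
Qed.

(** * Products of three palindromes *)

Definition three_palindrome_form w := exists A B P Q R,
  [/\ palindrome P, palindrome Q, palindrome R
    & w = A ++ B ++ P ++ Q ++ word_inv B ++ R ++ rev A
   \/ w = A ++ P ++ B ++ Q ++ R ++ word_inv B ++ rev A].

Definition shortenable3 p q r := exists p' q' r',
  [/\ palindrome p', palindrome q', palindrome r',
      size p' + size q' + size r' < size p + size q + size r
    & to_fg (p' ++ q' ++ r') = to_fg (p ++ q ++ r)].

(** Mirroring exchanges the two forms: it swaps [P] with [R] and replaces [B] by [B~^-1]. *)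
Lemma three_palindrome_form_rev w :
  three_palindrome_form (rev w) -> three_palindrome_form w.
Proof.
case=> A [B [P [Q [R [pP pQ pR ew]]]]].
move/eqP: (pP) => eP; move/eqP: (pQ) => eQ; move/eqP: (pR) => eR.
exists A, (iv B), R, Q, P; split=> //.
by case: ew => /(canRL revK) ->; [right | left];
  rewrite !rev_cat revK rev_word_inv word_inv_iv -eP -eQ -eR -!catA.
Qed.

Lemma shortenable3_rev p q r :
  palindrome p -> palindrome q -> palindrome r ->
  shortenable3 r q p -> shortenable3 p q r.
Proof.
move=> /eqP ep /eqP eq /eqP er [r' [q' [p' [pr pq pp lt /to_fg_eq e]]]].
exists p', q', r'; split=> //; first by lia.
apply/to_fg_eq; apply: (can_inj revK); rewrite -!reduce_rev !rev_cat -!catA.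
by rewrite -ep -eq -er -(eqP pp) -(eqP pq) -(eqP pr).
Qed.

Lemma shortenable_shortenable3 p q r :
  palindrome r -> shortenable p q -> shortenable3 p q r.
Proof.
move=> pr [p' [q' [pp pq lt e]]]; exists p', q', r; split=> //; first by lia.
by rewrite !catA !(to_fg_cat _ r) e.
Qed.

(** Serves the degenerate triples, whose product is [A p r A~]. A nonempty [B] separates the core
    from [A] and [A~]; for an empty [B], the words [P] and [R] do so, or one of them is empty and a
    hypothesis applies. *)
Lemma aligned_wrap A p r :
  reduced (A ++ rev A) -> reduced (A ++ p ++ rev A) ->
  reduced (A ++ r ++ rev A) ->
  aligned p r ->
  exists B P R, [/\ palindrome P, palindrome R,
    reduce (p ++ r) = B ++ P ++ R ++ word_inv B
    & reduced (A ++ (B ++ P ++ R ++ word_inv B) ++ rev A)].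
Proof.
move=> rA rp rr [B [P [R [pP pR ep er rw]]]]; exists B, P, R; split=> //.
  rewrite -[RHS]reduce_id //; apply/to_fg_eq.
  by rewrite ep er !to_fgE.
case: B => [|b B] in ep er rw *; last first.
  have rAB : reduced (A ++ b :: B).
    by move: rp; rewrite ep !catA => /reduced_catl/reduced_catl/reduced_catl.
  have rBA : reduced (word_inv (b :: B) ++ rev A).
    by move: rr; rewrite er -!catA => /reduced_catr/reduced_catr/reduced_catr.
  apply: reduced_glue => //; first exact: reduced_glue.
  move: rw; rewrite !catA => rw; rewrite -catA; apply: reduced_glue => //.
  by rewrite -size_eq0 size_word_inv.
rewrite /= cats0 in ep; rewrite /= cats0 in er rw *.
rewrite {p}ep in rp; rewrite {r}er in rr.
have [-> //|P0] := eqVneq P [::].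
have [->|R0] := eqVneq R [::]; first by rewrite cats0.
rewrite -catA; apply: reduced_glue => //.
  by move: rp; rewrite catA => /reduced_catl.
by apply: reduced_glue => //; apply: reduced_catr rr.
Qed.

(** Comparing the two decompositions of [q] shows that [D] is a prefix of [B~^-1]; the remainder [E]
    satisfies [Q' = E Q E~]. *)
Lemma aligned_triple p q r B P Q D Q' R :
  [/\ palindrome P, palindrome Q, palindrome Q' & palindrome R] ->
  [/\ reduced p, reduced q & reduced r] ->
  p = B ++ P ++ rev B -> q = iv B ++ Q ++ word_inv B ->
  q = D ++ Q' ++ rev D -> r = iv D ++ R ++ word_inv D ->
  reduced (B ++ P ++ Q ++ word_inv B) -> reduced (D ++ Q' ++ R ++ word_inv D) ->
  size D <= size B ->
  three_palindrome_form (reduce (p ++ q ++ r)) \/ shortenable3 p q r.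
Proof.
move=> [pP pQ pQ' pR] [rp rq rr] ep eq eq' er rBPQ rDQR leDB.
pose E := drop (size D) (iv B).
have eB : iv B = D ++ E.
  rewrite -[iv B](cat_take_drop (size D)); congr (_ ++ _).
  move: eq'; rewrite eq -{1}[iv B](cat_take_drop (size D)) -!catA => /eqP.
  by rewrite eqseq_cat ?size_takel ?size_map // => /andP[/eqP].
have {}eB : B = iv D ++ iv E by rewrite -map_cat -eB ivK.
have wiB : word_inv B = rev E ++ rev D.
  by rewrite eB -map_cat word_inv_iv rev_cat.
have eQ' : Q' = E ++ Q ++ rev E.
  move: eq'; rewrite eq wiB eB map_cat !ivK -!catA => /eqP.
  rewrite eqseq_cat // eqxx /= => /eqP e; apply/eqP; rewrite eq_sym.
  have /eqP := e; rewrite !catA eqseq_cat ?eqxx ?andbT -?catA 1?eq_sym //.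
  by move/(congr1 size): e; rewrite !size_cat; lia.
have [QE0|QE] := eqVneq (Q ++ rev E) [::]; last first.
  left; exists (iv D), (iv E), P, Q, R; split=> //; left.
  rewrite word_inv_iv -map_rev -[map _ (rev D)]word_inv_rev revK.
  rewrite -[RHS]reduce_id.
    apply/to_fg_eq; rewrite ep eq er eB !map_cat !rev_cat !word_inv_cat.
    by rewrite !ivK !rev_iv !word_inv_iv !to_fgE.
  (* The two halves overlap in [Q E~]: the left one is a prefix of [B P Q B^-1], the right one a
     suffix of [D Q' R D^-1]. *)
  have := @reduced_glue (iv D ++ iv E ++ P) (Q ++ rev E) (R ++ word_inv D) QE.
  rewrite -!catA; apply.
    by move: rBPQ; rewrite wiB eB !catA => /reduced_catl.
  by move: rDQR; rewrite eQ' -!catA => /reduced_catr/reduced_catr.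
have [Q0 E0] : Q = [::] /\ E = [::].
  move/nilP: QE0; rewrite /nilp size_cat addn_eq0 size_rev.
  by case/andP=> /nilP-> /nilP->.
have {}eB : B = iv D by rewrite eB E0 cats0.
(* Now [q = D D~] cancels completely against its neighbours, so that [P] and [R] meet and may cancel
   further. *)
rewrite {}eB {}Q0 {wiB eQ' QE0 E E0 leDB rBPQ rDQR eq' pQ' Q'} /= in ep eq *.
rewrite ivK rev_iv word_inv_iv in ep eq.
have rP : reduced P by move: rp; rewrite ep => /reduced_catr/reduced_catl.
have rR : reduced R by move: rr; rewrite er => /reduced_catr/reduced_catl.
have := @aligned_or_shortenable [::] P R pP pR.
rewrite /= !cats0 => /(_ rP rR) [/(@aligned_wrap (iv D))|].
  rewrite !rev_iv -ep -er => /(_ _ rp rr) [].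
    by move/reduced_word_inv: rq; rewrite eq word_inv_cat word_inv_rev.
  move=> B' [P' [R' [pP' pR' e rB]]]; left.
  exists (iv D), B', P', R', [::]; split=> //; left.
  rewrite cat0s rev_iv -[RHS]reduce_id; first apply/to_fg_eq; last first.
    by move: rB; rewrite -!catA.
  have {e} : to_fg (P ++ R) = to_fg (B' ++ P' ++ R' ++ word_inv B').
    by rewrite -e to_fg_reduce.
  rewrite ep eq er !to_fgE => e.
  by rewrite -!(mulgA (to_fg (rev D))^-1%g) e.
move=> [P' [R' [pP' pR' lt e]]]; right.
(* A shorter pair for [P R] is put back around the unchanged [q]. *)
exists (iv D ++ P' ++ word_inv D), q, (iv D ++ R' ++ word_inv D).
split; rewrite -?rev_iv ?palindrome_wrap //.
- by rewrite eq /palindrome rev_cat revK.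
- by move: lt; rewrite ep er !size_cat !rev_iv /=; lia.
- move: e; rewrite ep eq er !rev_iv !to_fgE => e.
  by rewrite -!(mulgA (to_fg (rev D))^-1%g) e.
Qed.

(** Strong induction on the total length: each shortening preserves the product, and reducing the
    factors first keeps them palindromes and does not lengthen them. *)
Lemma three_palindrome_form_reduce p q r :
  palindrome p -> palindrome q -> palindrome r ->
  three_palindrome_form (reduce (p ++ q ++ r)).
Proof.
have [n] := ubnP (size p + size q + size r).
elim: n p q r => // n IHn p0 q0 r0 le_n.
move=> /palindrome_reduce pp /palindrome_reduce pq /palindrome_reduce pr.
have -> : reduce (p0 ++ q0 ++ r0) =
    reduce (reduce p0 ++ reduce q0 ++ reduce r0).
  by apply/to_fg_eq; rewrite !to_fg_cat !to_fg_reduce.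
have := size_reduce p0; have := size_reduce q0; have := size_reduce r0.
have := reduced_reduce p0; have := reduced_reduce q0; have := reduced_reduce r0.
move: (reduce p0) (reduce q0) (reduce r0) pp pq pr.
move=> p q r pp pq pr rr rq rp ler leq lep.
have {p0 q0 r0 lep leq ler} le_n : size p + size q + size r <= n by lia.
suff [//|[p' [q' [r' [pp' pq' pr' lt /to_fg_eq <-]]]]] :
    three_palindrome_form (reduce (p ++ q ++ r)) \/ shortenable3 p q r.
  by apply: IHn => //; lia.
have pair u v : palindrome u -> palindrome v -> reduced u -> reduced v ->
    aligned u v \/ shortenable u v.
  have := @aligned_or_shortenable [::] u v.
  by rewrite /= !cats0.
have [apq|/(shortenable_shortenable3 pr)] := pair p q pp pq rp rq; last first.
  by right.
have [aqr|[q' [r' [pq' pr' lt e]]]] := pair q r pq pr rq rr; last first.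
  right; exists p, q', r'; split=> //; first by lia.
  by rewrite !(to_fg_cat p) e.
have [B [P [Q [pP pQ ep eq rBPQ]]]] := apq.
have [D [Q' [R [pQ' pR eq' er rDQR]]]] := aqr.
case: (leqP (size D) (size B)) => [leDB|/ltnW leBD].
  exact: (@aligned_triple p q r B P Q D Q' R).
have rRQD : reduced (iv D ++ R ++ Q' ++ rev D).
  rewrite -reduced_rev !rev_cat revK rev_iv -(eqP pR) -(eqP pQ') -!catA.
  exact: rDQR.
have rQPB : reduced (iv B ++ Q ++ P ++ rev B).
  rewrite -reduced_rev !rev_cat revK rev_iv -(eqP pP) -(eqP pQ) -!catA.
  exact: rBPQ.
(* When [D] is longer than [B], the mirrored product [r q p] has [D~^-1] in the role of [B] and
   [B~^-1] in that of [D]. *)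
have := @aligned_triple r q p (iv D) R Q' (iv B) Q P.
rewrite !ivK !rev_iv !word_inv_iv !size_map.
move=> /(_ _ _ er eq' eq ep rRQD rQPB leBD).
case=> // [form|]; last by right; apply: shortenable3_rev.
left; apply: three_palindrome_form_rev.
by rewrite -reduce_rev !rev_cat -catA -(eqP pp) -(eqP pq) -(eqP pr).
Qed.

End Words.

Theorem theorem2 (Sigma : choiceType) (g : freegroup Sigma) :
  (exists s : seq (freegroup Sigma),
     [/\ (size s <= 3)%N, all (@is_palindrome Sigma) s
       & g = (\prod_(p <- s) p)%g])
  <->
  (exists A B P Q R : word Sigma,
     [/\ palindrome P, palindrome Q, palindrome R
       & reduced_form g = A ++ B ++ P ++ Q ++ word_inv B ++ R ++ rev A
      \/ reduced_form g = A ++ P ++ B ++ Q ++ R ++ word_inv B ++ rev A]).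
Proof.
split=> [[s [le3 pals ->]]|[A [B [P [Q [R [pP pQ pR eg]]]]]]].
  (* Shorter products are padded with empty palindromes. *)
  suff [p [q [r [pp pq pr ->]]]] : exists p q r,
      [/\ palindrome p, palindrome q, palindrome r
        & (\prod_(p <- s) p)%g = to_fg (p ++ q ++ r)].
    exact: three_palindrome_form_reduce.
  case: s le3 pals => [|p [|q [|r [|? ?]]]] //= _ pals.
  - by exists [::], [::], [::]; rewrite big_nil to_fg_nil.
  - case/andP: pals => pp _; exists (reduced_form p), [::], [::].
    by rewrite big_seq1 !cats0 reduced_form_fgK.
  - case/and3P: pals => pp pq _.
    exists (reduced_form p), (reduced_form q), [::].
    by rewrite big_cons big_seq1 !cats0 to_fg_cat !reduced_form_fgK.
  - case/and4P: pals => pp pq pr _.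
    exists (reduced_form p), (reduced_form q), (reduced_form r).
    by rewrite !big_cons big_nil mulg1 !to_fg_cat !reduced_form_fgK.
have pal w u : palindrome w -> is_palindrome (to_fg (u ++ w ++ rev u)).
  by move=> pw; apply: palindrome_reduce; rewrite palindrome_wrap.
case: eg => eg; rewrite -(reduced_form_fgK g) eg.
  (* With [C = A B], the factors are [C P C~], [C~^-1 Q C^-1] and [A R A~]. *)
  exists [:: to_fg ((A ++ B) ++ P ++ rev (A ++ B));
             to_fg (iv (A ++ B) ++ Q ++ rev (iv (A ++ B)));
             to_fg (A ++ R ++ rev A)].
  split; rewrite /= ?pal // !big_cons big_nil mulg1.
  by rewrite !rev_iv !map_cat !rev_cat !word_inv_cat !to_fgE.
(* Each factor is [u w u~] for a palindrome [w], with [u] chosen to cancel the tail of the preceding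
   factor: [A], then [A~^-1 B], then [A B~^-1]. *)
exists [:: to_fg (A ++ P ++ rev A);
           to_fg ((iv A ++ B) ++ Q ++ rev (iv A ++ B));
           to_fg ((A ++ iv B) ++ R ++ rev (A ++ iv B))].
split; rewrite /= ?pal // !big_cons big_nil mulg1.
by rewrite !rev_cat !rev_iv !to_fgE.
Qed.
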